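(* Assume that $k=2^{\beta}M$, with $\beta > 0$ and $M$ is an odd positive integer. Then $\phi(n)/|\mathcal{U}_k(n)|=1$ if and only if $n$ is a divisor of $$2^{\beta+2}\prod_{p \in \mathcal{A}} p \prod_{ q\in \mathcal{B}} q^{\nu_{q}(M)+1},$$ where $$\mathcal{A}:=\left\{p: p \text{ is prime, } p\nmid M \text{ and } p=2^{l}d+1, \text{ with } 0<l\leq \beta \text{ and } d|M\right\},$$ and $$\mathcal{B}:=\left\{q: q \text{ is prime, } q|M \text{ and } q=2^ld+1, \text{ with } 0<l\leq \beta \text{ and } d|M\right\}.$$
   Context: For a positive integer $k$ and a positive integer $n$, $\mathcal{U}_k(n)=\{a\in\mathcal{U}(\mathbb{Z}_n): a^k=1\}$ denotes the set of $k$-units modulo $n$, where $\mathcal{U}(\mathbb{Z}_n)$ is the unit group of $\mathbb{Z}_n$. $\phi$ is Euler's totient function and $\nu_q(M)$ is the exponent of the largest power of the prime $q$ dividing $M$. Thus $\phi(n)/|\mathcal{U}_k(n)|=1$ means every unit $u$ modulo $n$ satisfies $u^k=1$. *)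

(* Defs.v *)
From mathcomp Require Import all_boot all_order all_algebra all_fingroup.

Set Implicit Arguments.
Unset Strict Implicit.
Unset Printing Implicit Defensive.

Import GRing.Theory.
Local Open Scope nat_scope.

(* 'Z_n is built with modulus at least 2, so 'Z_1 is really Z/2.  Its unit
   group is trivial, as is that of the zero ring Z/1, so kunits k 1 still has
   the right cardinality; card_kunits confirms this for every n > 0. *)
Definition kunits (k n : nat) : {set {unit 'Z_n}} :=
  [set a in units_Zp n | a ^+ k == 1]%g.

Lemma card_kunits (k n : nat) : 0 < n ->
  #|kunits k n| =
  #|[set a : 'I_n | [exists b : 'I_n, a * b == 1 %[mod n]]
                    & (a ^ k)%N == 1 %[mod n]]|.
Proof.
case: n => [|[|n]] // _.
  have unit1 (a : {unit 'Z_1}) : a = 1%g.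
    apply: val_inj; have := valP a; case: (val a) => [[|[|m]] ltm] // _.
    exact: val_inj.
  rewrite [LHS](_ : _ = #|[set (1%g : {unit 'Z_1})]|); last first.
    by apply: eq_card => a; rewrite !inE (unit1 a) expg1n !eqxx.
  rewrite [RHS](_ : _ = #|[set: 'I_1]|); first by rewrite cards1 cardsT card_ord.
  apply: eq_card => a; rewrite !inE !modn1 eqxx andbT.
  by apply/existsP; exists ord0; rewrite !modn1.
rewrite -(card_imset _ val_inj).
apply: eq_card => a; rewrite [in RHS]inE.
have valX (u : {unit 'Z_n.+2}) : (val (u ^+ k)%g == 1%R) = ((val u ^ k)%N == 1 %[mod n.+2]).
  rewrite FinRing.val_unitX -val_eqE /=.
  have -> : (FinRing.uval u ^+ k)%R = inZp (FinRing.uval u ^ k) :> 'Z_n.+2.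
    by rewrite -Zp_nat natrX natr_Zp.
  by [].
have unitE (u : 'Z_n.+2) : [exists b : 'I_n.+2, (u * b)%N == 1 %[mod n.+2]] = (u \is a GRing.unit).
  apply/existsP/idP => [[b /eqP ub]|uU].
    apply/GRing.unitrPr; exists b; apply: val_inj => /=; exact: ub.
  by exists (u^-1)%R; have /(congr1 val) /= := GRing.mulrV uU => ->.
apply/imsetP/andP => [[u]|[]].
  rewrite inE => /andP[_ /eqP uk1] ->; split; last by rewrite -valX uk1.
  by rewrite unitE; apply: valP.
rewrite unitE => aU ak1; exists (FinRing.unit 'Z_n.+2 aU) => //.
by rewrite !inE -val_eqE /= valX.
Qed.

Definition pow2_shape (beta M p : nat) : bool :=
  [exists l : 'I_beta.+1, (0 < l) && has (fun d => p == 2 ^ l * d + 1) (divisors M)].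

Definition setA (beta M : nat) : pred nat :=
  [pred p | [&& prime p, ~~ (p %| M) & pow2_shape beta M p]].

Definition setB (beta M : nat) : pred nat :=
  [pred q | [&& prime q, q %| M & pow2_shape beta M q]].

Lemma pow2_shapeP (beta M p : nat) : 0 < M ->
  reflect (exists l d, [/\ 0 < l <= beta, d %| M & p = 2 ^ l * d + 1])
          (pow2_shape beta M p).
Proof.
move=> M0; apply: (iffP existsP) => [[l /andP[l0 /hasP[d]]]|[l [d [/andP[l0 lb] dM ->]]]].
  rewrite -dvdn_divisors // => dM /eqP->; exists l, d.
  by rewrite l0 -ltnS ltn_ord.
exists (Ordinal (lb : l < beta.+1)); rewrite l0 /=.
by apply/hasP; exists d; rewrite // -dvdn_divisors.
Qed.

(* Hence products over setA and setB may be taken over p < (2 ^ beta * M).+2. *)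
Lemma pow2_shape_bound (beta M p : nat) : 0 < M ->
  pow2_shape beta M p -> p < (2 ^ beta * M).+2.
Proof.
move=> M0 /(pow2_shapeP _ _ M0)[l [d [/andP[_ lb] dM ->]]].
by rewrite addn1 !ltnS leq_mul ?leq_pexp2l // dvdn_leq.
Qed.

(* Main.v *)
(** By the Chinese remainder theorem, every unit modulo [n] satisfies [u ^ k = 1]
    iff this holds modulo [n`_p] for each prime [p].  Modulo an odd prime power
    [p ^ e], a primitive root modulo [p] and the element [1 + p], of order
    [p ^ (e - 1)], show that it amounts to [p - 1 %| k] and [e <= logn p k + 1].
    Modulo [2 ^ e], with [k] even, the element [5] shows that it amounts to
    [e <= logn 2 k + 2].  These are the exponents of the given product, as
    [p - 1 %| 2 ^ beta * M] iff [p] has the shape [2 ^ l * d + 1]. *)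

Require Import Defs.
From mathcomp Require Import all_boot all_order all_algebra all_fingroup.
From mathcomp Require Import cyclic zify ring.

Import GRing.Theory.
Local Open Scope nat_scope.

(** Phrased with congruences of naturals, so that [n = 1] is uniform and the modulus can be changed
    freely. *)
Definition units_killed (k n : nat) : Prop :=
  forall a, coprime a n -> a ^ k = 1 %[mod n].

(** The solutions [S] of [a ^ k = 1] lie among the [totient n] residues [T] coprime to [n], and [S]
    is nonempty, so the ratio is 1 exactly when [S] fills [T]. *)
Lemma kunits_ratioP (k n : nat) : 0 < k -> 0 < n ->
  ((totient n)%:R / (#|kunits k n|)%:R = 1 :> rat)%R <-> units_killed k n.
Proof.
move=> k0 n0.
set S := [set a : 'I_n | a ^ k == 1 %[mod n]].
set T := [set a : 'I_n | coprime a n].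
have cardS : #|kunits k n| = #|S|.
  rewrite card_kunits //; apply: eq_card => a; rewrite !inE.
  apply/andP/idP => [[]//|ak]; split=> //; apply/existsP.
  have lt: a ^ k.-1 %% n < n by rewrite ltn_mod.
  exists (Ordinal lt) => /=.
  by rewrite modnMmr -expnS prednK.
have cardT : #|T| = totient n.
  rewrite totient_count_coprime big_mkord -sum1_card big_mkcond /=.
  by apply: eq_bigr => i _; rewrite inE coprime_sym; case: coprime.
have sub : S \subset T.
  apply/subsetP => a; rewrite !inE => /eqP ak.
  by rewrite -(coprime_pexpl _ _ k0) -coprime_modl ak coprime_modl coprime1n.
have S0 : 0 < #|S|.
  have lt: 1 %% n < n by rewrite ltn_mod.
  apply/card_gt0P; exists (Ordinal lt).
  by rewrite !inE /= modnXm exp1n.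
have -> : ((totient n)%:R / (#|kunits k n|)%:R = 1 :> rat)%R <-> #|S| == #|T|.
  rewrite cardS -cardT; split=> [|/eqP ->].
    move/(congr1 (fun x => x * #|S|%:R)%R).
    rewrite mulfVK ?mul1r ?Num.Theory.pnatr_eq0 -?lt0n // => /eqP.
    by rewrite Num.Theory.eqr_nat eq_sym.
  by rewrite divff // Num.Theory.pnatr_eq0 -lt0n (leq_trans S0) // subset_leq_card.
rewrite (subset_leqif_card sub); split=> [/subsetP ST a an|H].
  have lt: a %% n < n by rewrite ltn_mod.
  have := ST (Ordinal lt); rewrite !inE /= coprime_modl => /(_ an).
  by rewrite modnXm => /eqP.
by apply/subsetP => a; rewrite !inE => /H /eqP.
Qed.

Lemma units_killed_dvdP (k n : nat) : 0 < n ->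
  units_killed k n <-> forall a, coprime a n -> n %| a ^ k - 1.
Proof.
case: n => [|[|n]] // _; first by split=> // _ a _; rewrite /= !modn1.
(* A modulus of at least 2 rules out [a = 0], so [a ^ k - 1] is not truncated. *)
have aux a : coprime a n.+2 -> 1 <= a ^ k.
  by rewrite expn_gt0; case: a => //; rewrite /coprime gcd0n.
by split=> H a an; have := H a an; rewrite -eqn_mod_dvd ?aux // => /eqP.
Qed.

Lemma units_killed_parts (k n : nat) : 0 < n ->
  units_killed k n <-> forall p, p \in \pi(n) -> units_killed k n`_p.
Proof.
move=> n0; split=> [H p pn a ap|H].
  have co : coprime n`_p n`_p^' := coprime_partC _ _ _.
  (* Being 1 modulo the complementary part, this lift of [a] is a unit modulo all of [n]. *)
  pose x := chinese n`_p n`_p^' a 1.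
  have x1 : x = a %[mod n`_p] := chinese_modl co _ _.
  have x2 : x = 1 %[mod n`_p^'] := chinese_modr co _ _.
  have : coprime x n.
    rewrite -(partnC p n0) coprimeMr -coprime_modl x1 coprime_modl ap.
    by rewrite -coprime_modl x2 coprime_modl coprime1n.
  move/H => xk; rewrite -modnXm -x1 modnXm.
  by rewrite -(modn_dvdm _ (dvdn_part p n)) xk modn_dvdm // dvdn_part.
apply/units_killed_dvdP => // a an; apply/dvdn_partP => // p pn.
have [killed _] := units_killed_dvdP k n`_p (part_gt0 _ _).
by apply: killed (H p pn) _ _; apply: coprime_dvdr (dvdn_part _ _) an.
Qed.

(** * Valuations of powers of 1 + p ^ s *)

Lemma expn_1D (m y : nat) : exists z, (1 + y) ^ m = 1 + m * y + y ^ 2 * z.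
Proof.
elim: m => [|m [z IH]]; first by exists 0; rewrite expn0 muln0.
by exists (m + z + y * z); rewrite expnS IH; ring.
Qed.

(** In the binomial expansion the linear term has valuation exactly [s + 1], and all later terms are
    divisible by [p ^ s.+2]. For the last one this requires [s + 2 <= s * p], which fails for
    [p = 2], [s = 1]. *)
Lemma expn_prime_1D (p s c : nat) : prime p -> 0 < s -> odd p || (1 < s) ->
  ~~ (p %| c) ->
  exists2 c', ~~ (p %| c') & (1 + p ^ s * c) ^ p = 1 + p ^ s.+1 * c'.
Proof.
move=> pp s0 ps pc; have p1 := prime_gt1 pp.
have [q pE] : exists q, p = q.+2 by exists (p - 2); lia.
have /dvdnP[z zE] : p ^ s.+2 %|
    \sum_(i < q.+1) 'C(p, i.+2) * (1 ^ (p - i.+2) * (p ^ s * c) ^ i.+2).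
  apply: dvdn_sum => i _; rewrite exp1n mul1n expnMn -expnM mulnA dvdn_mulr //.
  (* Inner binomial coefficients supply a factor [p]; the last term must rely on its exponent
     [s * p]. *)
  have [lti|lei] := ltnP i.+2 p.
    apply: dvdn_trans (_ : p * p ^ (s * i.+2) %| _).
      by rewrite -expnS dvdn_exp2l //; nia.
    by rewrite dvdn_mul // prime_dvd_bin.
  apply: dvdn_mull; apply: dvdn_exp2l.
  have iE : i.+2 = p by have := ltn_ord i; lia.
  rewrite iE; case/orP: ps => [op|]; last by nia.
  by have := odd_prime_gt2 op pp; nia.
exists (c + z * p); first by rewrite dvdn_addl // dvdn_mull.
have sumE (F : nat -> nat) : \sum_(i < p.+1) F i = F 0 + (F 1 + \sum_(i < q.+1) F i.+2).
  by rewrite pE big_ord_recl big_ord_recl.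
rewrite expnDn (sumE (fun i => 'C(p, i) * (1 ^ (p - i) * (p ^ s * c) ^ i))) zE.
by rewrite bin0 bin1 !exp1n !expnS; ring.
Qed.

Lemma expn_pfactor_1D (p s v : nat) : prime p -> 0 < s -> odd p || (1 < s) ->
  exists2 c, ~~ (p %| c) & (1 + p ^ s) ^ (p ^ v) = 1 + p ^ (s + v) * c.
Proof.
move=> pp s0 ps; elim: v => [|v [c pc IH]].
  by exists 1; [rewrite dvdn1; have := prime_gt1 pp; lia | rewrite addn0 muln1].
have [||c' pc' cE] := @expn_prime_1D p (s + v) c pp _ _ pc.
- by rewrite addn_gt0 s0.
- by case/orP: ps => [->//|lt]; rewrite orbC ltn_addr.
by exists c'; rewrite // expnSr expnM IH cE addnS.
Qed.

(** Write [k] as [m * p ^ v] with [p] not dividing [m]. The [p ^ v]-th power brings the valuation of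
    the difference from 1 to exactly [s + v], and the [m]-th power leaves it there. *)
Lemma leq_pfactor_dvd_expn_1D (p s k e : nat) :
    prime p -> 0 < s -> odd p || (1 < s) -> 0 < k ->
  p ^ e %| (1 + p ^ s) ^ k - 1 -> e <= s + logn p k.
Proof.
move=> pp s0 ps k0; have [m pm kE] := pfactor_coprime pp k0.
have [c pc cE] := @expn_pfactor_1D p s (logn p k) pp s0 ps.
rewrite {1}kE mulnC expnM cE; set t := s + logn p k.
have t0 : 0 < t by rewrite addn_gt0 s0.
have [z ->] := expn_1D m (p ^ t * c).
have -> : 1 + m * (p ^ t * c) + (p ^ t * c) ^ 2 * z - 1 =
          p ^ t * (m * c + p ^ t * (c ^ 2 * z)).
  by rewrite -addnA addKn; ring.
case: leqP => // lt /(dvdn_trans (dvdn_exp2l p lt)).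
rewrite expnSr dvdn_pmul2l ?expn_gt0 ?prime_gt0 // dvdn_addl.
  by move: pm; rewrite prime_coprime // Euclid_dvdM // (negPf pc) orbF => /negPf->.
by rewrite dvdn_mulr // dvdn_exp.
Qed.

Lemma units_killed_prime (k p : nat) : prime p ->
  units_killed k p -> p.-1 %| k.
Proof.
move=> pp; have /cyclicP[x xE] := units_Zp_cyclic pp.
(* The generator [x] is a primitive root, so [x ^ k = 1] forces its order to divide [k]. *)
have <- : #[x]%g = p.-1.
  by rewrite orderE -xE card_units_Zp ?prime_gt0 // -[in LHS](expn1 p)
             totient_pfactor // muln1.
rewrite order_dvdn => H; apply/eqP/val_inj; rewrite FinRing.val_unitX.
have p1 := prime_gt1 pp; have xU := valP x.
have : coprime (\val x) p.
  by rewrite coprime_sym -unitZpE // natr_Zp.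
move/H => xk; rewrite -[X in (X ^+ _)%R]natr_Zp -natrX.
by apply: val_inj; rewrite [LHS]val_Zp_nat // xk modn_small //.
Qed.

Lemma units_killed_odd_pfactor (k p e : nat) :
    prime p -> odd p -> 0 < e -> 0 < k ->
  units_killed k (p ^ e) <-> (p.-1 %| k) && (e <= (logn p k).+1).
Proof.
move=> pp op e0 k0; have p0 := prime_gt0 pp.
have pe0 : 0 < p ^ e by rewrite expn_gt0 p0.
split=> [H|/andP[p1k ek] a ap].
  apply/andP; split.
    apply: units_killed_prime => // a ap.
    have pd : p %| p ^ e by rewrite dvdn_exp.
    by rewrite -(modn_dvdm _ pd) H ?modn_dvdm // coprimeXr.
  rewrite -add1n; apply: leq_pfactor_dvd_expn_1D => //; first by rewrite op.
  apply: (proj1 (units_killed_dvdP _ _ pe0)) => //.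
  by rewrite coprimeXr // expn1 -coprime_modl modnDr coprime_modl coprime1n.
(* The totient is [p.-1 * p ^ e.-1], a product of coprime factors that both divide [k]; Euler's
   theorem concludes. *)
have : totient (p ^ e) %| k.
  rewrite totient_pfactor // Gauss_dvd.
    by rewrite p1k pfactor_dvdn //; lia.
  by rewrite coprimeXr // coprimePn.
case/dvdnP => q ->; rewrite mulnC expnM -modnXm Euler_exp_totient //.
by rewrite modnXm exp1n.
Qed.

Lemma odd_expn_pow2 (a b : nat) : odd a ->
  exists z, a ^ (2 ^ b.+1) = 1 + 2 ^ b.+3 * z.
Proof.
move=> oa; elim: b => [|b [z IH]].
  have [q aE] : exists q, a = 2 * q + 1 by exists a./2; lia.
  (* This parity gives an odd square the residue 1 modulo 8; each further squaring gains a factor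
     2. *)
  have /dvdnP[r rE] : 2 %| q * q.+1 by rewrite dvdn2 oddM /=; case: odd.
  exists r; rewrite aE expn1; transitivity (1 + 4 * (q * q.+1)); first by ring.
  by rewrite rE; ring.
exists (z + 2 ^ b.+2 * z ^ 2); rewrite expnSr expnM IH.
by rewrite !expnS; ring.
Qed.

Lemma units_killed_pow2 (b M e : nat) : 0 < b -> odd M ->
  units_killed (2 ^ b * M) (2 ^ e) <-> e <= b + 2.
Proof.
move=> b0 oM; have M0 : 0 < M by case: M oM.
have e0 : 0 < 2 ^ e by rewrite expn_gt0.
have k0 : 0 < 2 ^ b * M by rewrite muln_gt0 expn_gt0.
split=> [H|le a ap].
  have -> : b + 2 = 2 + logn 2 (2 ^ b * M).
    by rewrite mulnC logn_Gauss ?coprime2n // pfactorK // addnC.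
  (* Taken with [p = 2] and [s = 2], that is, for the unit 5. *)
  apply: leq_pfactor_dvd_expn_1D => //.
  apply: (proj1 (units_killed_dvdP _ _ e0)) => //.
  by rewrite coprimeXr.
case: e => [|e] in le ap e0 *; first by rewrite !modn1.
have oa : odd a by rewrite coprime_pexpr // coprimen2 in ap.
have [z] := odd_expn_pow2 a b.-1 oa; rewrite prednK // => zE.
have bE : b.+2 = e.+1 + (b + 2 - e.+1) by lia.
have aE : a ^ 2 ^ b = 1 %[mod 2 ^ e.+1].
  by rewrite zE bE expnD -mulnA addnC [X in X + 1]mulnC modnMDl.
by rewrite expnM -modnXm aE modnXm exp1n.
Qed.

Lemma logn_prod_primes (p : nat) (r : seq nat) (P : pred nat) (e : nat -> nat) :
    prime p -> uniq r -> (forall q, P q -> prime q) ->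
  logn p (\prod_(q <- r | P q) q ^ e q) = if (p \in r) && P p then e p else 0.
Proof.
move=> pp ur Pp; elim: r ur => [|x r IH] /=; first by rewrite big_nil logn1.
case/andP => xr /IH {}IH; rewrite big_cons inE.
case: ifP => [Px|nPx]; last first.
  by rewrite IH; case: eqVneq => //= ->; rewrite nPx andbF.
have px := Pp x Px.
rewrite lognM ?expn_gt0 ?(prime_gt0 px) //; last first.
  by apply: prodn_cond_gt0 => q /Pp qp; rewrite expn_gt0 prime_gt0.
rewrite IH lognX logn_prime //.
case: eqVneq => [->|_] /=; last by rewrite muln0.
by rewrite (negPf xr) Px muln1 addn0.
Qed.

Lemma pow2_shape_dvd (b M p : nat) : 0 < b -> odd M -> prime p ->
  pow2_shape b M p = odd p && (p.-1 %| 2 ^ b * M).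
Proof.
move=> b0 oM pp; have M0 : 0 < M by case: M oM.
have p1 := prime_gt1 pp.
apply/pow2_shapeP/andP => // [[l [d [/andP[l0 lb] dM ->]]]|[op p1k]].
  rewrite addn1 /= oddM oddX eqn0Ngt l0 /=; split=> //.
  by rewrite dvdn_mul // dvdn_exp2l.
have q0 : 0 < p.-1 by lia.
have [d d2 pE] := pfactor_coprime (isT : prime 2) q0.
(* Here [l] is the 2-adic valuation of [p - 1], positive as [p] is odd, and [d] is its odd part. *)
exists (logn 2 p.-1), d; split.
- apply/andP; split.
    by rewrite logn_gt0 mem_primes q0 dvdn2; case: (p) op p1.
  have -> : b = logn 2 (2 ^ b * M).
    by rewrite mulnC logn_Gauss ?coprime2n // pfactorK.
  by apply: dvdn_leq_log => //; rewrite muln_gt0 expn_gt0.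
- rewrite -(@Gauss_dvdr _ (2 ^ b)); last by rewrite coprimeXr // coprime_sym.
  by apply: dvdn_trans p1k; rewrite pE dvdn_mulr.
by rewrite mulnC -pE; lia.
Qed.

Theorem theorem12 (k beta M n : nat) (beta_gt0 : 0 < beta) (M_odd : odd M)
    (kE : k = 2 ^ beta * M) (n_gt0 : 0 < n) :
  ((totient n)%:R / (#|kunits k n|)%:R = 1 :> rat)%R <->
  n %| 2 ^ (beta + 2)
       * (\prod_(0 <= p < k.+2 | p \in setA beta M) p)
       * (\prod_(0 <= q < k.+2 | q \in setB beta M) q ^ (logn q M + 1)).
Proof.
have M0 : 0 < M by case: M M_odd {kE}.
have k0 : 0 < k by rewrite kE muln_gt0 expn_gt0.
have prA q : q \in setA beta M -> prime q by case/and3P.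
have prB q : q \in setB beta M -> prime q by case/and3P.
(* The exponent 1 lets [logn_prod_primes] treat both products. *)
rewrite (eq_bigr (fun q => q ^ 1)) => [|q _]; last by rewrite expn1.
set A := \prod_(_ <= _ < _ | _) _ ^ 1; set B := \prod_(_ <= _ < _ | _) _.
have A0 : 0 < A.
  by apply: prodn_cond_gt0 => q /prA qp; rewrite expn_gt0 prime_gt0.
have B0 : 0 < B.
  by apply: prodn_cond_gt0 => q /prB qp; rewrite expn_gt0 prime_gt0.
(* An odd [p] with [p.-1 %| k] occurs in exactly one product: in [A] with exponent 1 when
   [logn p M = 0], otherwise in [B] with exponent [logn p M + 1]. Since [logn p M = logn p k], the
   two cases merge. *)
have lognE p : prime p -> logn p (2 ^ (beta + 2) * A * B) =
    if p == 2 then beta + 2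
    else if p.-1 %| k then (logn p k).+1 else 0.
  move=> pp; rewrite !lognM ?muln_gt0 ?expn_gt0 ?A0 //.
  rewrite !logn_prod_primes ?iota_uniq // lognX logn_prime //.
  have le : pow2_shape beta M p -> p \in index_iota 0 k.+2.
    by move=> /(pow2_shape_bound M0); rewrite mem_index_iota kE.
  have -> : (p \in index_iota 0 k.+2) && (p \in setA beta M) =
            ~~ (p %| M) && pow2_shape beta M p.
    rewrite [p \in setA _ _]inE pp /=.
    by case sp: pow2_shape; rewrite ?andbF // le.
  have -> : (p \in index_iota 0 k.+2) && (p \in setB beta M) =
            (p %| M) && pow2_shape beta M p.
    rewrite [p \in setB _ _]inE pp /=.
    by case sp: pow2_shape; rewrite ?andbF // le.
  rewrite pow2_shape_dvd // -kE.
  have [->|p2] := eqVneq p 2; first by rewrite /= !andbF muln1 !addn0.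
  have op : odd p by case: (even_prime pp) p2 => [->|].
  have p2' : coprime p (2 ^ beta) by rewrite coprimeXr // coprimen2.
  rewrite op muln0 add0n /= kE (logn_Gauss _ p2').
  case: (p.-1 %| _); rewrite ?andbF //= !andbT.
  case: ifP => [/negPf pM|/negbFE ->]; last by rewrite addn1.
  by rewrite pM lognE pM !andbF.
rewrite kunits_ratioP // units_killed_parts //.
suff eqv p : p \in \pi(n) ->
    units_killed k n`_p <-> n`_p %| 2 ^ (beta + 2) * A * B.
  by split=> [H|/(dvdn_partP _ n_gt0) H];
     [apply/dvdn_partP => // p pn | move=> p pn]; apply/(eqv p pn)/H.
move=> pn; have pp : prime p by move: pn; rewrite /= mem_primes => /and3P[].
have e0 : 0 < logn p n by rewrite logn_gt0.
rewrite p_part pfactor_dvdn ?muln_gt0 ?expn_gt0 ?A0 // lognE //.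
have [->|p2] := eqVneq p 2; first by rewrite kE; apply: units_killed_pow2.
have op : odd p by case: (even_prime pp) p2 => [->|].
rewrite units_killed_odd_pfactor //.
(* If [p.-1] does not divide [k], the allowed exponent is 0, whereas [p] divides [n], so both sides
   fail. *)
by case: (p.-1 %| k) => //=; rewrite leqNgt e0.
Qed.
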